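(* Let $1<p<\infty$ and let $C_1$ be the finite continuous Cesàro operator on the complex Banach space $L^p[0,1]$, $(C_1f)(x)=\frac1x\int_0^x f(t)\,dt$. If $0<\lambda\le 1$, then $\lambda$ is an extended eigenvalue for $C_1$ on $L^p[0,1]$, and a corresponding extended eigenoperator is the weighted composition operator $X_0\in\mathcal B(L^p[0,1])$ defined by $$(X_0f)(x)=x^{(1-\lambda)/\lambda}\,f(x^{1/\lambda}).$$
   Context: $\mathcal B(E)$ denotes the algebra of bounded linear operators on a complex Banach space $E$. A complex scalar $\lambda$ is an extended eigenvalue of $T\in\mathcal B(E)$ if there is a nonzero $X\in\mathcal B(E)$ with $TX=\lambda XT$; such an $X$ is called an extended eigenoperator of $T$ corresponding to $\lambda$. It is a known fact that $C_1$ is bounded on $L^p[0,1]$ for $1<p<\infty$. *)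

(* Defs.v *)
From HB Require Import structures.
From mathcomp Require Import all_boot all_order all_algebra.
From mathcomp Require Import generic_quotient ring_quotient.
From mathcomp Require Import all_classical all_reals all_analysis.
From mathcomp Require Import measurable_realfun complex.

Set Implicit Arguments.
Unset Strict Implicit.
Unset Printing Implicit Defensive.

Import Order.TTheory GRing.Theory Num.Theory.
Import numFieldNormedType.Exports.
Import ComplexField.Normc.

Local Open Scope classical_set_scope.
Local Open Scope ring_scope.
Local Open Scope complex_scope.

Section complex_Lfun.
Context d (T : measurableType d) (R : realType).
Variable mu : {measure set T -> \bar R}.

(* [R[i]] carries no sigma-algebra in the library: a complex function is
   measurable when its real and imaginary parts are, which is Borel
   measurability for C = R^2. *)
Definition complex_measurable (f : T -> R[i]) : Prop :=
  measurable_fun setT (fun x => complex.Re (f x)) /\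
  measurable_fun setT (fun x => complex.Im (f x)).

(* [normc z : R] is the modulus of [z], and [`|z| = (normc z)%:C]. *)
Definition cLnorm (p : R) (f : T -> R[i]) : \bar R :=
  'N[mu]_p%:E[EFin \o (fun x => normc (f x))]%E.

Definition cLfun_pred (p : R) : {pred T -> R[i]} :=
  [pred f | `[< complex_measurable f /\ (cLnorm p f < +oo)%E >]].

(* The p-integrable functions themselves, before a.e. identification.
   As for [LfunType], the proof [p1] is what makes the vector space and
   norm instances below available. *)
Record cLfunType (p : R) (p1 : 1 <= p) := CLfun {
  cLfun_val :> T -> R[i] ;
  cLfun_valP : cLfun_val \in cLfun_pred p }.

Section p_fixed.
Variables (p : R) (p1 : 1 <= p).

HB.instance Definition _ := [isSub for @cLfun_val p p1].
HB.instance Definition _ := [Choice of cLfunType p1 by <:].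

Lemma complex_measurable_normc (f : T -> R[i]) : complex_measurable f ->
  measurable_fun setT (fun x => normc (f x)).
Proof.
move=> [mr mi].
have -> : (fun x => normc (f x)) = (fun x => Num.sqrt
    (complex.Re (f x) ^+ 2 + complex.Im (f x) ^+ 2)).
  by apply/funext => x; case: (f x).
apply: (@measurableT_comp _ _ _ _ _ _ (@Num.sqrt R)).
  by apply: continuous_measurable_fun; exact: sqrt_continuous.
by apply: measurable_funD; exact: measurable_funX.
Qed.

Lemma ReM (a z : R[i]) : complex.Re (a * z) =
  complex.Re a * complex.Re z - complex.Im a * complex.Im z.
Proof. by case: a z => [a b] [c e]. Qed.

Lemma ImM (a z : R[i]) : complex.Im (a * z) =
  complex.Re a * complex.Im z + complex.Im a * complex.Re z.
Proof. by case: a z => [a b] [c e]. Qed.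

Lemma complex_measurableD (f g : T -> R[i]) :
  complex_measurable f -> complex_measurable g -> complex_measurable (f + g).
Proof.
move=> [fr fi] [gr gi]; split.
- have -> : (fun x => complex.Re ((f + g) x)) =
      (fun x => complex.Re (f x)) \+ (fun x => complex.Re (g x)).
    by apply/funext => x; rewrite /= fctE raddfD.
  exact: measurable_funD.
- have -> : (fun x => complex.Im ((f + g) x)) =
      (fun x => complex.Im (f x)) \+ (fun x => complex.Im (g x)).
    by apply/funext => x; rewrite /= fctE raddfD.
  exact: measurable_funD.
Qed.

Lemma complex_measurableZ (a : R[i]) (f : T -> R[i]) :
  complex_measurable f -> complex_measurable (a *: f).
Proof.
move=> [fr fi]; split.
- under eq_fun do rewrite fctE /= ReM.
  by apply: measurable_funB; apply: measurable_funM => //; exact: measurable_cst.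
- under eq_fun do rewrite fctE /= ImM.
  by apply: measurable_funD; apply: measurable_funM => //; exact: measurable_cst.
Qed.


Let p0 : 0 < p. Proof. exact: lt_le_trans p1. Qed.

Lemma cLfunP (f : T -> R[i]) : reflect
  (complex_measurable f /\ (cLnorm p f < +oo)%E) (f \in cLfun_pred p).
Proof. exact: asboolP. Qed.

Lemma Lfun_normc (f : T -> R[i]) :
  complex_measurable f -> (cLnorm p f < +oo)%E ->
  (fun x => normc (f x)) \in Lfun mu p%:E.
Proof.
move=> mf nf; rewrite inE; apply/andP; split; rewrite inE; last exact: nf.
exact: complex_measurable_normc.
Qed.

Lemma le_Lnorm_EFin (u v : T -> R) :
  measurable_fun setT u -> measurable_fun setT v ->
  (forall x, 0 <= u x <= v x) ->
  ('N[mu]_p%:E[EFin \o u] <= 'N[mu]_p%:E[EFin \o v])%E.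
Proof.
move=> mu_ mv uv; rewrite unlock /Lnorm.
have mp (w : T -> R) : measurable_fun setT w ->
    measurable_fun setT (fun x => `|(EFin \o w) x| `^ p)%E.
  move=> mw; apply: (@measurableT_comp _ _ _ _ _ _ (fun x => x `^ p)%E) => //=.
    exact: measurable_poweR.
  by apply/measurable_EFinP; exact: measurableT_comp.
apply: (@gt0_ler_poweR _ p^-1).
- by rewrite invr_ge0 ltW.
- by rewrite in_itv/= leey integral_ge0// => x _; exact: poweR_ge0.
- by rewrite in_itv/= leey integral_ge0// => x _; exact: poweR_ge0.
apply: ge0_le_integral => //.
- by move=> x _; exact: poweR_ge0.
- exact: mp.
- exact: mp.
- move=> x _ /=; have /andP[u0 uvx] := uv x.
  have v0 := le_trans u0 uvx.
  rewrite lee_fin !ger0_norm//.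
  by apply: ge0_ler_powR; rewrite ?nnegrE// ltW.
Qed.

Lemma cLnormD (f g : T -> R[i]) :
  complex_measurable f -> complex_measurable g ->
  (cLnorm p (f + g)%R <= cLnorm p f + cLnorm p g)%E.
Proof.
move=> mf mg.
have mnf := complex_measurable_normc mf.
have mng := complex_measurable_normc mg.
apply: le_trans (minkowski_EFin mu mnf mng p1).
apply: le_Lnorm_EFin.
- exact/complex_measurable_normc/complex_measurableD.
- exact: measurable_funD.
- move=> x; apply/andP; split; last exact: (le_normcD (f x) (g x)).
  by rewrite -lecR; exact: (normr_ge0 ((f + g) x)).
Qed.

Lemma cLnormZ (a : R[i]) (f : T -> R[i]) :
  complex_measurable f -> (cLnorm p f < +oo)%E ->
  cLnorm p (a *: f) = ((normc a)%:E * cLnorm p f)%E.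
Proof.
move=> mf nf; have pE1 : (1 <= p%:E)%E by [].
have := LnormZ (Lfun_Sub pE1 (Lfun_normc mf nf)) (normc a).
rewrite ger0_norm; last by rewrite -lecR; exact: (normr_ge0 a).
move=> <-; apply: eq_Lnorm => x /=; congr EFin.
exact: (normcM a (f x)).
Qed.

Lemma cLnorm_ae_eq (f g : T -> R[i]) :
  complex_measurable f -> complex_measurable g ->
  f = g %[ae mu] -> cLnorm p f = cLnorm p g.
Proof.
move=> mf mg fg; rewrite /cLnorm unlock; congr (_ `^ _)%E.
have mp (w : T -> R[i]) : complex_measurable w ->
    measurable_fun setT (fun x => `|(EFin \o (fun y => normc (w y))) x| `^ p)%E.
  move=> mw; apply: (@measurableT_comp _ _ _ _ _ _ (fun x => x `^ p)%E) => //=.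
    exact: measurable_poweR.
  apply/measurable_EFinP; apply: measurableT_comp => //.
  exact: complex_measurable_normc.
apply: ae_eq_integral => //; [exact: mp|exact: mp|].
by apply: filterS fg => x fgx Dx /=; rewrite fgx.
Qed.

Lemma cLfun_submod_closed : submod_closed (cLfun_pred p).
Proof.
split.
  apply/cLfunP; split; first by split; exact: measurable_cst.
  rewrite /cLnorm (_ : _ \o _ = cst 0%E).
    by rewrite Lnorm0// eqe gt_eqF.
  by apply/funext => x /=; congr EFin; exact: normc0.
move=> a f g /cLfunP[mf nf] /cLfunP[mg ng].
have mZ := complex_measurableZ a mf.
apply/cLfunP; split; first exact: complex_measurableD.
apply: le_lt_trans (cLnormD mZ mg) _; apply: lte_add_pinfty => //.
rewrite cLnormZ// lte_mul_pinfty// lee_fin -lecR; exact: (normr_ge0 a).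
Qed.

HB.instance Definition _ := GRing.isSubmodClosed.Build R[i] (T -> R[i])
  (cLfun_pred p) cLfun_submod_closed.
HB.instance Definition _ := [SubChoice_isSubLmodule of cLfunType p1 by <:].

Definition cLfun_null : {pred cLfunType p1} :=
  [pred f : cLfunType p1 | `[< (f : T -> R[i]) = 0 %[ae mu] >]].

Lemma cLfun_null_submod_closed : submod_closed cLfun_null.
Proof.
split; first by apply/asboolP; exact: ae_eq_refl.
move=> a f g /asboolP f0 /asboolP g0; apply/asboolP.
apply: filterS2 f0 g0 => x f0 g0 Dx.
rewrite [LHS](_ : _ = a * f x + g x)//.
by rewrite f0// g0// mulr0 addr0.
Qed.

HB.instance Definition _ := GRing.isSubmodClosed.Build R[i] (cLfunType p1)
  cLfun_null cLfun_null_submod_closed.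

(* The space L^p(mu) of complex functions modulo a.e. equality;
   [cLclass f] is the class of [f]. *)
Definition cLspace : Type := Quotient.quot cLfun_null.
HB.instance Definition _ := GRing.Zmodule.on cLspace.
HB.instance Definition _ := EqQuotient.on cLspace.


Definition cLspace_fun (F : cLspace) : T -> R[i] := cLfun_val (repr F).

Definition cLclass (f : cLfunType p1) : cLspace := \pi_cLspace%qT f.

Lemma cLclassP (f g : cLfunType p1) :
  cLclass f = cLclass g <-> (f : T -> R[i]) = g %[ae mu].
Proof.
have fgE : (f - g \in cLfun_null) <-> (f : T -> R[i]) = g %[ae mu].
  split=> [/asboolP fg|fg]; last apply/asboolP.
    by apply: filterS fg => x /[apply] fgx; exact: subr0_eq.
  apply: filterS fg => x /[apply] fgx.
  by rewrite [LHS](_ : _ = f x - g x)// fgx subrr.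
rewrite -fgE Quotient.idealrBE; split => [fg|/eqP//]; exact/eqP.
Qed.

Lemma cLclassK (F : cLspace) : cLclass (repr F) = F.
Proof. exact: reprK. Qed.

Lemma cLspace_fun_ae (f : cLfunType p1) :
  cLspace_fun (cLclass f) = f %[ae mu].
Proof. by apply/cLclassP; exact: cLclassK. Qed.

Lemma cLclassD (f g : cLfunType p1) : cLclass (f + g) = cLclass f + cLclass g.
Proof. exact: (raddfD (\pi_(Quotient.quot cLfun_null))%qT). Qed.

Definition cLscale (a : R[i]) (F : cLspace) : cLspace :=
  cLclass (a *: repr F).

Lemma cLclassZ (a : R[i]) (f : cLfunType p1) :
  cLclass (a *: f) = cLscale a (cLclass f).
Proof.
apply/cLclassP; apply: filterS (cLspace_fun_ae f) => x /[apply] fx.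
by rewrite [LHS](_ : _ = a * f x)// -fx.
Qed.

Let cLscaleA a b F : cLscale a (cLscale b F) = cLscale (a * b) F.
Proof. by rewrite -(cLclassK F) -!cLclassZ scalerA. Qed.

Let cLscale1 : left_id 1 cLscale.
Proof. by move=> F; rewrite -(cLclassK F) -cLclassZ scale1r. Qed.

Let cLscaleDr : right_distributive cLscale +%R.
Proof.
move=> a F G; rewrite -(cLclassK F) -(cLclassK G) -cLclassD -!cLclassZ.
by rewrite scalerDr cLclassD.
Qed.

Let cLscaleDl F : {morph cLscale^~ F : a b / a + b}.
Proof.
by move=> a b; rewrite -(cLclassK F) -!cLclassZ scalerDl cLclassD.
Qed.

HB.instance Definition _ := GRing.Zmodule_isLmodule.Build R[i] cLspace
  cLscaleA cLscale1 cLscaleDr cLscaleDl.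

Definition cLspace_norm (F : cLspace) : R[i] :=
  (fine (cLnorm p (cLspace_fun F)))%:C.

Lemma cLspace_norm_class (f : cLfunType p1) :
  cLspace_norm (cLclass f) = (fine (cLnorm p f))%:C.
Proof.
rewrite /cLspace_norm (@cLnorm_ae_eq _ f)//.
- by have /cLfunP[] := cLfun_valP (repr (cLclass f)).
- by have /cLfunP[] := cLfun_valP f.
- exact: cLspace_fun_ae.
Qed.

Let fin_cLnorm (f : cLfunType p1) : cLnorm p f \is a fin_num.
Proof.
have /cLfunP[_ fy] := cLfun_valP f.
by rewrite ge0_fin_numE// Lnorm_ge0.
Qed.

Let cLspace_normD (F G : cLspace) :
  cLspace_norm (F + G) <= cLspace_norm F + cLspace_norm G.
Proof.
rewrite -(cLclassK F) -(cLclassK G) -cLclassD !cLspace_norm_class.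
rewrite -rmorphD/= lecR -lee_fin EFinD.
rewrite (fineK (fin_cLnorm (_ + _))) !(fineK (fin_cLnorm (repr _))).
have /cLfunP[mf _] := cLfun_valP (repr F).
have /cLfunP[mg _] := cLfun_valP (repr G).
exact: cLnormD.
Qed.

Let cLspace_normZ (a : R[i]) (F : cLspace) :
  cLspace_norm (a *: F) = `|a| * cLspace_norm F.
Proof.
rewrite [a *: F](_ : _ = cLclass (a *: repr F))// -[in RHS](cLclassK F).
rewrite !cLspace_norm_class.
have /cLfunP[mf fy] := cLfun_valP (repr F).
rewrite [cLnorm _ _](cLnormZ a mf fy) fineM//.
by rewrite rmorphM.
Qed.

Let cLspace_norm_eq0 (F : cLspace) : cLspace_norm F = 0 -> F = 0.
Proof.
rewrite -(cLclassK F) cLspace_norm_class => -[N0].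
have cLclass0 : cLclass 0 = 0.
  by apply: (addrI (cLclass 0)); rewrite -cLclassD !addr0.
rewrite -cLclass0; apply/cLclassP.
have /cLfunP[mf _] := cLfun_valP (repr F).
have : (cLnorm p (repr F) = 0)%E by rewrite -(fineK (fin_cLnorm _)) N0.
have mn : measurable_fun setT (EFin \o (fun x => normc (repr F x))).
  by apply/measurable_EFinP; exact: complex_measurable_normc.
have pE0 : (0 < p%:E)%E by rewrite lte_fin.
move=> /(Lnorm_eq0_eq0 mn pE0); apply: filterS => x /[apply] -[].
exact: eq0_normc.
Qed.

HB.instance Definition _ := Lmodule_isNormed.Build R[i] cLspace
  cLspace_normD cLspace_normZ cLspace_norm_eq0.

End p_fixed.
End complex_Lfun.

Section bounded_operators.
Context (R : realType).
Implicit Types E : normedModType R[i].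

Record bounded_operator E := BoundedOperator {
  bounded_operator_linear :> {linear E -> E} ;
  bounded_operatorP : exists M : R,
    forall f : E, `|bounded_operator_linear f| <= M%:C * `|f| }.

Definition extended_eigenoperator E (T : bounded_operator E) (lambda : R[i])
    (X : bounded_operator E) : Prop :=
  (exists f : E, X f != 0) /\ (forall f : E, T (X f) = lambda *: X (T f)).

Definition extended_eigenvalue E (T : bounded_operator E) (lambda : R[i])
    : Prop :=
  exists X : bounded_operator E, extended_eigenoperator T lambda X.

End bounded_operators.

Section Lp_unit_interval.
Context (R : realType).

(* Lebesgue measure on [0, 1], as a measure on the whole line carried by
   [0, 1]: functions are taken modulo equality a.e. on [0, 1]. *)
Definition leb01 : {measure set (measurableTypeR R) -> \bar R} :=
  mrestr (@lebesgue_measure R) (measurable_itv `[0, 1]).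

Section p_fixed.
Variables (p : R) (p1 : 1 < p).

Definition Lp01 : normedModType R[i] := cLspace leb01 (ltW p1).

Definition cesaro_fun (f : R -> R[i]) (x : R) : R[i] :=
  (x^-1)%:C *
  (\int[@lebesgue_measure R]_(t in `[0, x]) complex.Re (f t) +i*
   \int[@lebesgue_measure R]_(t in `[0, x]) complex.Im (f t)).

Definition weighted_comp_fun (lambda : R) (f : R -> R[i]) (x : R) : R[i] :=
  (x `^ ((1 - lambda) / lambda))%:C * f (x `^ (1 / lambda)).

(* [X] is the operator on L^p[0, 1] given by the formula [Phi]: it maps the
   class of every p-integrable function [f] to the class of [Phi f]. *)
Definition given_by (X : bounded_operator Lp01)
    (Phi : (R -> R[i]) -> (R -> R[i])) : Prop :=
  forall f : cLfunType leb01 (ltW p1),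
    cLspace_fun (X (cLclass f)) = Phi f %[ae leb01].

End p_fixed.
End Lp_unit_interval.

(* Main.v *)
(* For a = 1/lambda >= 1, the substitution y = x^a turns the measure
   a x^(a-1) dx on [0, 1] into Lebesgue measure on [0, 1].  Since
   x^((a-1)p) <= x^(a-1) <= a x^(a-1) there, X_0 is a contraction of L^p, and
   since (1-lambda)/lambda = a - 1, the same substitution gives
     (C_1 X_0 f)(x) = x^-1 \int_0^x t^(a-1) f(t^a) dt
                    = lambda x^-1 \int_0^(x^a) f = lambda (X_0 C_1 f)(x). *)
Require Import Defs.
From HB Require Import structures.
From mathcomp Require Import all_boot all_order all_algebra.
From mathcomp Require Import generic_quotient.
From mathcomp Require Import all_classical all_reals all_analysis.
From mathcomp Require Import measurable_realfun complex.

Set Implicit Arguments.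
Unset Strict Implicit.
Unset Printing Implicit Defensive.

Import Order.TTheory GRing.Theory Num.Theory.
Import numFieldNormedType.Exports.
Import ComplexField.Normc.

Local Open Scope classical_set_scope.
Local Open Scope ring_scope.
Local Open Scope complex_scope.

(** * Measures with a nonnegative density *)

Section density.
Local Open Scope ereal_scope.
Context d (T : measurableType d) (R : realType).
Variables (mu : {measure set T -> \bar R}) (w : T -> R).

(** The proofs [mw] and [w0] are arguments so that the measure structure declared below can be
    inferred from the term alone. *)
Definition density (mw : measurable_fun setT w) (w0 : forall x, (0 <= w x)%R) :=
  fun A : set T => \int[mu]_(x in A) (w x)%:E.

Variables (mw : measurable_fun setT w) (w0 : forall x, (0 <= w x)%R).

Local Notation nu := (density mw w0).

Let density0 : nu set0 = 0.
Proof. exact: integral_set0. Qed.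

Let density_ge0 A : 0 <= nu A.
Proof. by apply: integral_ge0 => x _; rewrite lee_fin. Qed.

Let density_sigma_additive : semi_sigma_additive nu.
Proof.
move=> F mF tF _; rewrite /density ge0_integral_bigcup//=.
- by apply: is_cvg_ereal_nneg_natsum_cond => n _ _; exact: density_ge0.
- by apply/measurable_EFinP; exact: measurable_funS mw.
- by move=> x _; rewrite lee_fin.
Qed.

HB.instance Definition _ :=
  isMeasure.Build _ _ _ nu density0 density_ge0 density_sigma_additive.

Import HBNNSimple.

(** For indicators this is the definition of [density]; additivity gives simple functions, and the
    simple functions [f_] increasing to [f] give the general case by monotone convergence on both
    sides. *)
Lemma ge0_integral_density (f : T -> \bar R) :
  measurable_fun setT f -> (forall x, 0 <= f x) ->
  \int[nu]_x f x = \int[mu]_x ((w x)%:E * f x).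
Proof.
move=> mf f0; pose f_ := nnsfun_approx measurableT mf.
have f_cvg x : (f_ n x)%:E @[n --> \oo] --> f x.
  by apply: (cvg_nnsfun_approx measurableT mf) => //.
have f_nd x : {homo (fun n => f_ n x) : m n / (m <= n)%N >-> (m <= n)%R}.
  by move=> m n mn; exact/lefP/nd_nnsfun_approx.
transitivity (limn (fun n => \int[nu]_x (f_ n x)%:E)).
  rewrite -monotone_convergence//.
  - by apply: eq_integral => x _; apply/esym/cvg_lim => //; exact: f_cvg.
  - by move=> n; exact/measurable_EFinP/measurable_funTS.
  - by move=> n x _; rewrite lee_fin.
  - by move=> x _ m n mn; rewrite lee_fin f_nd.
rewrite [X in limn X](_ : _ = fun n => \int[mu]_x ((w x)%:E * (f_ n x)%:E)).
  rewrite -monotone_convergence//.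
  - apply: eq_integral => x _; apply/cvg_lim => //.
    by apply: cvgeZl => //; exact: f_cvg.
  - move=> n; apply: emeasurable_funM; first exact/measurable_EFinP.
    exact/measurable_EFinP/measurable_funTS.
  - by move=> n x _; rewrite mule_ge0// lee_fin.
  - by move=> x _ m n mn; rewrite lee_wpmul2l ?lee_fin// f_nd.
apply/funext => n.
transitivity (\sum_(k \in range (f_ n))
    \int[mu]_x ((w x)%:E * (k * \1_(f_ n @^-1` [set k]) x)%:E)).
  under eq_integral do rewrite fimfunE -fsumEFin//.
  rewrite ge0_integral_fsum//; last 2 first.
  - by move=> y; exact/measurable_EFinP/measurable_funM.
  - by move=> y x _; rewrite nnfun_muleindic_ge0.
  apply: eq_fsbigr => r /set_mem[x _ <-{r}].
  rewrite integralZl_indic_nnsfun// integral_indic//= setIT.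
  rewrite /density integral_mkcond -ge0_integralZl//; last 3 first.
  - apply/(measurable_restrictT _ _).1 => //.
    exact/measurable_EFinP/measurable_funTS.
  - by move=> y _; apply: erestrict_ge0 => z _; rewrite lee_fin.
  - by rewrite lee_fin.
  apply: eq_integral => y _; rewrite patchE indicE.
  by case: ifPn => _; rewrite ?mulr1 ?mulr0 ?mule0// muleC.
rewrite -ge0_integral_fsum//.
- apply: eq_integral => x _; rewrite -ge0_mule_fsumr => [|k].
    by rewrite fsumEFin// -fimfunE.
  exact: nnfun_muleindic_ge0.
- move=> k; apply: emeasurable_funM; apply/measurable_EFinP => //.
  exact: measurable_funM.
- move=> k x _; apply: mule_ge0; first by rewrite lee_fin.
  exact: nnfun_muleindic_ge0.
Qed.

End density.

(** * Lebesgue measure carried by [0, 1] *)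

Section leb01.
Local Open Scope ereal_scope.
Context (R : realType).
Local Notation leb := (@lebesgue_measure R).
Local Notation leb01 := (leb01 R).

Lemma integral_leb01 (A : set R) (f : R -> \bar R) : A `<=` `[0%R, 1%R] ->
  \int[leb01]_(x in A) f x = \int[leb]_(x in A) f x.
Proof.
move=> A01; apply: eq_measure_integral => B mB BA.
by rewrite [LHS]/(leb _) setIidl//; exact: subset_trans A01.
Qed.

Lemma ge0_integral_leb01 (A : set R) (f : R -> \bar R) :
  measurable (A : set (measurableTypeR R)) ->
  measurable_fun (A : set (measurableTypeR R)) f ->
  (forall x, A x -> 0 <= f x) ->
  \int[leb01]_(x in A) f x = \int[leb]_(x in A `&` `[0%R, 1%R]) f x.
Proof.
move=> mA mf f0.
have m01 : measurable (`[0%R, 1%R]%classic : set (measurableTypeR R)).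
  exact: measurable_itv.
rewrite [LHS](@ge0_negligible_integral _ _ _ leb01 A (~` `[0%R, 1%R]))//.
- by rewrite setDE setCK integral_leb01//; exact: subIsetr.
- exact: measurableC.
- by rewrite [LHS]/(leb _) setICl measure0.
Qed.

(** The exceptional set meets [0, 1] only in the point 0. The identities between powers and inverses
    of x need x > 0, so the pointwise arguments below are carried out on ]0, 1]. *)
Lemma leb01_ae_gt0_le1 : {ae leb01, forall x : R, (0 < x <= 1)%R}.
Proof.
exists (~` `]0%R, 1%R]); split.
- by apply: measurableC; exact: measurable_itv.
- rewrite [LHS]/(leb _) (_ : _ `&` _ = [set 0%R]).
    exact: lebesgue_measure_set1.
  apply/seteqP; split => [x /=|x ->/=]; rewrite !in_itv/= ?lexx ?ler01 ?ltxx//.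
  move=> [x01 /andP[x0 x1]]; apply/eqP; rewrite eq_le x0 andbT leNgt.
  by apply/negP => x0'; apply: x01; rewrite x0'.
- by move=> x; apply: contra_not => /=; rewrite in_itv/=.
Qed.

End leb01.

(** * The substitution y = x^a on [0, 1], for a >= 1 *)

Section power_substitution.
Local Open Scope ereal_scope.
Context (R : realType) (a : R) (a1 : (1 <= a)%R).
Local Notation leb := (@lebesgue_measure R).
Local Notation leb01 := (leb01 R).

Let a0 : (0 < a)%R.
Proof. exact: lt_le_trans a1. Qed.

Local Notation w := (fun x : measurableTypeR R => a * x `^ (a - 1))%R.
Local Notation phi :=
  (fun x : measurableTypeR R => x `^ a : measurableTypeR R)%R.

Let mw : measurable_fun setT w.
Proof. by apply: measurable_funM => //; exact: measurable_powR. Qed.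

Let w0 x : (0 <= w x)%R.
Proof. by rewrite mulr_ge0 ?powR_ge0// ltW. Qed.

Let mphi : measurable_fun setT phi.
Proof. exact: measurable_powR. Qed.

(** The exponent 0 is a separate case: it occurs as a - 1 when a = 1, and the value at 0 is then 1
    instead of 0. *)
Lemma powR_cvg_at_right0 (b : R) : (0 <= b)%R ->
  (x `^ b)%R @[x --> 0%R^'+] --> (0 `^ b)%R.
Proof.
rewrite le_eqVlt => /predU1P[<-|b0].
  by under eq_fun do rewrite powRr0; rewrite powRr0; exact: cvg_cst.
by rewrite powR0 ?gt_eqF//; exact: powR_cvg0.
Qed.

Lemma continuous_powR (b x : R) : (0 < x)%R ->
  {for x, continuous (fun y => y `^ b)%R}.
Proof.
move=> x0; apply/differentiable_continuous/derivable1_diffP.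
by apply: derivable_powR; rewrite in_itv/= x0.
Qed.

(** Fundamental theorem of calculus with primitive x^a; a >= 1 keeps the integrand continuous up to
    0. *)
Lemma integral_powR_itv (s : R) : (0 < s)%R ->
  \int[leb]_(x in `[0%R, s]) (w x)%:E = (s `^ a)%:E.
Proof.
move=> s0; rewrite (@continuous_FTC2 _ w (@powR R ^~ a))//.
- by rewrite powR0 ?gt_eqF// sube0.
- apply/continuous_within_itvP => //; split.
  + move=> x; rewrite in_itv/= => /andP[x0 _].
    by apply: cvgM; [exact: cvg_cst|exact: continuous_powR].
  + apply: cvgM; first exact: cvg_cst.
    by apply: powR_cvg_at_right0; rewrite subr_ge0.
  + apply: cvgM; first exact: cvg_cst.
    by apply: cvg_at_left_filter; exact: continuous_powR.
- split.
  + move=> x; rewrite in_itv/= => /andP[x0 _].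
    by apply: derivable_powR; rewrite in_itv/= x0.
  + by apply: powR_cvg_at_right0; exact: ltW.
  + by apply: cvg_at_left_filter; exact: continuous_powR.
- move=> x; rewrite in_itv/= => /andP[x0 _].
  by rewrite powR_derive1// in_itv/= x0.
Qed.

Let one_powR (b : R) : (1 `^ b = 1)%R.
Proof. by rewrite powR1. Qed.

(** The two shapes are those of the sets x^a < t within [0, 1]: half-open when 0 < t <= 1, all of
    [0, 1] when t > 1. Intersecting with [0, 1] also discards negative x. *)
Let w_itv (A : set R) (s : R) : (0 < s)%R ->
  (A `&` `[0%R, 1%R]%classic = `[0%R, s[%classic \/
   A `&` `[0%R, 1%R]%classic = `[0%R, s]%classic) ->
  measurable (A : set (measurableTypeR R)) ->
  density leb01 mw w0 A = (s `^ a)%:E.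
Proof.
move=> s0 As mA; rewrite /density ge0_integral_leb01//.
- rewrite -integral_powR_itv//; case: As => -> //.
  rewrite integral_itv_bndo_bndc//.
  by apply/measurable_EFinP; exact: measurable_funTS.
- by apply/measurable_EFinP; exact: measurable_funTS.
- by move=> x _; rewrite lee_fin.
Qed.

Let leb01_itv (A : set R) (s : R) : (0 <= s)%R ->
  (A `&` `[0%R, 1%R]%classic = `[0%R, s[%classic \/
   A `&` `[0%R, 1%R]%classic = `[0%R, s]%classic) ->
  leb01 A = s%:E.
Proof.
move=> s0 As; rewrite [LHS]/(leb _).
have itvE (b : bool) : leb [set` Interval (BLeft 0%R) (BSide b s)] = s%:E.
  rewrite lebesgue_measure_itv/= lte_fin; case: ltP => [_|s0'].
    by rewrite sube0.
  by congr EFin; apply/eqP; rewrite eq_le s0.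
by case: As => ->; exact: itvE.
Qed.

(** It suffices to compare the measures on the rays ]-oo, t[, which are closed under intersection
    and generate the Borel sets. *)
Lemma leb01_pushforward_powR (A : set (measurableTypeR R)) : measurable A ->
  leb01 A = pushforward (density leb01 mw w0) phi A.
Proof.
pose nu : {measure set (measurableTypeR R) -> \bar R} :=
  pushforward (density leb01 mw w0) phi.
have mray (t : R) : measurable (phi @^-1` `]-oo, t[).
  by rewrite -[X in measurable X]setTI; exact: mphi.
move=> mA; rewrite -[RHS]/(nu mphi A).
apply: (@measure_unique _ R (measurableTypeR R) (@RGenInftyO.G R)
  (fun k => `]-oo, k%:R[%classic) _ _ _ _ leb01 (nu mphi) _ _ A mA).
- exact: RGenInftyO.measurableE.
- move=> _ _ [x ->] [y ->]; exists (Num.min x y).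
  apply/seteqP; split => z /=; rewrite !in_itv/= lt_min; first by case=> -> ->.
  by move/andP.
- by move=> k; exists k%:R.
- rewrite -subTset => x _; exists (Num.truncn x).+1 => //=.
  by rewrite in_itv/= truncnS_gt.
- move=> _ [t ->]; rewrite -[RHS]/(density leb01 mw w0 (phi @^-1` `]-oo, t[)).
  (* For t <= 0 both sides vanish: powers are nonnegative, and the ray misses [0, 1]. *)
  have [t0|t0] := leP t 0%R.
    rewrite (_ : _ @^-1` _ = set0); last first.
      apply/seteqP; split => // x /=; rewrite in_itv/= => /lt_le_trans/(_ t0).
      by rewrite ltNge powR_ge0.
    rewrite measure0; apply: leb01_itv => //; left.
    apply/seteqP; split => x /=; rewrite !in_itv/=.
      by case=> xt /andP[x0 _]; rewrite x0 (lt_le_trans xt).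
    by case/andP => x0; rewrite ltNge x0.
  (* For t > 1 the ray and its preimage both contain [0, 1], and both sides are 1. *)
  have [t1|t1] := leP t 1%R; last first.
    rewrite (w_itv ltr01)//; last first.
      right; apply/seteqP; split => x /=; rewrite !in_itv/=; first by case.
      move=> /andP[x0 x1]; rewrite x0 x1; split=> //; apply: le_lt_trans t1.
      rewrite -(one_powR a); apply: ge0_ler_powR => //; rewrite ?nnegrE//.
      exact: ltW.
    rewrite one_powR; apply: leb01_itv => //.
    right; apply/seteqP; split => x /=; rewrite !in_itv/=; first by case.
    by move=> /andP[x0 x1]; rewrite x0 x1; split=> //; exact: le_lt_trans t1.
  (* [s] solves s^a = t, so within [0, 1] the preimage of the ray is [0, s[, of weighted mass s^a =
     t. *)
  pose s := (t `^ a^-1)%R.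
  have s0 : (0 < s)%R by exact: powR_gt0.
  have sat : (s `^ a = t)%R.
    by rewrite -powRrM mulVf ?gt_eqF// powRr1// ltW.
  have s1 : (s <= 1)%R.
    rewrite -(one_powR a^-1); apply: ge0_ler_powR => //;
      rewrite ?nnegrE ?invr_ge0; exact: ltW.
  rewrite (w_itv s0)//; last first.
    left; apply/seteqP; split => x /=; rewrite !in_itv/=.
      move=> [xat /andP[x0 x1]]; rewrite x0/= ltNge; apply/negP => sx.
      move: xat; rewrite -sat ltNge => /negP; apply.
      by apply: ge0_ler_powR => //; rewrite ?nnegrE; exact: ltW.
    move=> /andP[x0 xs]; rewrite x0 (le_trans (ltW xs))//; split=> //.
    by rewrite -sat; apply: gt0_ltr_powR => //; rewrite nnegrE// ltW.
  rewrite sat; apply: leb01_itv; first exact: ltW.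
  left; apply/seteqP; split => x /=; rewrite !in_itv/=.
    by move=> [xt /andP[x0 _]]; rewrite x0 xt.
  by move=> /andP[x0 xt]; rewrite x0 xt (le_trans (ltW xt)).
(* Uniqueness asks for finite mass on an exhausting sequence; here the total mass is 1. *)
- move=> k; apply: (@le_lt_trans _ _ (leb01 setT)).
    by apply: le_measure; rewrite ?inE.
  by rewrite (@leb01_itv _ 1%R)// ?ltry//; right; rewrite setTI.
Qed.

(** Replace [leb01] by the pushforward, move the integral to the source, then unfold the density. *)
Lemma ge0_integral_leb01_powR (f : measurableTypeR R -> \bar R) :
  measurable_fun setT f -> (forall x, 0 <= f x) ->
  \int[leb01]_x f x = \int[leb01]_x ((a * x `^ (a - 1))%:E * f (x `^ a)%R).
Proof.
move=> mf f0.
transitivity (\int[pushforward (density leb01 mw w0) phi]_x f x).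
  by apply: eq_measure_integral => A mA _; exact: leb01_pushforward_powR.
rewrite ge0_integral_pushforward// preimage_setT ge0_integral_density//.
  exact: measurableT_comp.
by move=> x; exact: f0.
Qed.

(** The preimage of a null set has weighted mass zero by the pushforward identity, and the weight is
    positive for x > 0, so the preimage is itself null. This is what lets composition with x^a act
    on classes. *)
Lemma leb01_ae_powR (P : R -> Prop) :
  {ae leb01, forall x, P x} -> {ae leb01, forall x, P (x `^ a)%R}.
Proof.
move=> [N [mN N0 PN]].
have mphiN : measurable (phi @^-1` N).
  by rewrite -[X in measurable X]setTI; exact: mphi.
have mwN : measurable_fun (phi @^-1` N) (EFin \o w).
  by apply/measurable_EFinP; exact: measurable_funTS.
have /(ae_eq_integral_abs leb01 mphiN mwN) wN0 :
    \int[leb01]_(x in phi @^-1` N) `|(EFin \o w) x| = 0.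
  rewrite -N0; rewrite leb01_pushforward_powR//.
  by apply: eq_integral => x _; rewrite /= ger0_norm.
apply: filterS2 wN0 (leb01_ae_gt0_le1 R) => x wNx /andP[x0 _].
apply: contrapT => nPx; have /wNx/eqP : N (x `^ a)%R by exact: PN.
by rewrite eqe mulf_eq0 !gt_eqF// powR_gt0.
Qed.

(** The substitution is applied to [h] cut off to [0, b^a]: for x > 0, x^a lies in that interval
    exactly when x lies in [0, b]. Both intervals sit inside [0, 1], where [leb] and [leb01]
    agree. *)
Lemma ge0_integral_itv_powR (h : measurableTypeR R -> \bar R) (b : R) :
  measurable_fun setT h -> (forall x, 0 <= h x) -> (0 < b <= 1)%R ->
  a%:E * \int[leb]_(t in `[0%R, b]) ((t `^ (a - 1))%:E * h (t `^ a)%R) =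
  \int[leb]_(t in `[0%R, (b `^ a)%R]) h t.
Proof.
move=> mh h0 /andP[b0 b1].
have ba1 : (b `^ a <= 1)%R.
  by rewrite -(one_powR a); apply: ge0_ler_powR => //;
    rewrite ?nnegrE; exact: ltW.
rewrite -[RHS]integral_leb01; last first.
  by move=> x /=; rewrite !in_itv/= => /andP[-> /le_trans->].
rewrite -integral_leb01; last first.
  by move=> x /=; rewrite !in_itv/= => /andP[-> /le_trans->].
have mitv (c : R) : measurable (`[0%R, c]%classic : set (measurableTypeR R)).
  exact: measurable_itv.
have itvE (x : R) : (0 < x)%R ->
    ((x `^ a)%R \in `[0%R, (b `^ a)%R]%classic) = (x \in `[0%R, b]%classic).
  move=> x0; apply/idP/idP; rewrite !inE/= !in_itv/= => /andP[_ xb].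
    rewrite (ltW x0)/= leNgt; apply/negP => bx.
    move: xb; rewrite leNgt => /negP; apply.
    by apply: gt0_ltr_powR => //; rewrite nnegrE ltW.
  by rewrite powR_ge0/=; apply: ge0_ler_powR => //;
    rewrite ?nnegrE; exact: ltW.
have mr (c : R) (k : measurableTypeR R -> \bar R) : measurable_fun setT k ->
    measurable_fun setT (k \_ `[0%R, c]).
  move=> mk; apply: (measurable_restrictT k (mitv c)).1.
  exact: measurable_funTS.
have mw1 : measurable_fun setT
    (fun x : measurableTypeR R => (x `^ (a - 1))%:E * h (x `^ a)%R).
  apply: emeasurable_funM; last exact: measurableT_comp.
  by apply/measurable_EFinP; exact: measurable_powR.
have w1_ge0 x : 0 <= (x `^ (a - 1))%:E * h (x `^ a)%R.
  by rewrite mule_ge0// lee_fin powR_ge0.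
have a_ge0 : 0 <= a%:E by rewrite lee_fin ltW.
rewrite -ge0_integralZl//; last exact: measurable_funTS.
rewrite integral_mkcond [RHS]integral_mkcond.
rewrite [RHS]ge0_integral_leb01_powR//; last 2 first.
- exact: mr.
- by move=> x; exact: erestrict_ge0.
apply: ge0_ae_eq_integral => //.
- by apply: mr; exact: measurable_funeM.
- apply: emeasurable_funM; first exact/measurable_EFinP.
  apply: measurableT_comp => //.
  exact: mr.
- by move=> x _; apply: erestrict_ge0 => y _; exact: mule_ge0.
- move=> x _; apply: mule_ge0; first by rewrite lee_fin.
  exact: erestrict_ge0.
- have [N [mN N0 sN]] := leb01_ae_gt0_le1 R; exists N; split => //.
  apply: subset_trans sN => x; apply: contra_not => /= /andP[x0 x1] _.
  by rewrite !patchE itvE//; case: ifPn => _; rewrite ?mule0// EFinM muleA.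
Qed.

(** Multiplication by t^(a-1) >= 0 commutes with taking positive and negative parts, so the
    nonnegative case applies to each part of [g]. *)
Lemma Rintegral_itv_powR (g : measurableTypeR R -> R) (b : R) :
  measurable_fun setT g -> (0 < b <= 1)%R ->
  (a * \int[leb]_(t in `[0%R, b]) (t `^ (a - 1) * g (t `^ a)) =
  \int[leb]_(t in `[0%R, b `^ a]) g t)%R.
Proof.
move=> mg b01; pose G : measurableTypeR R -> \bar R := EFin \o g.
have mG : measurable_fun setT G by exact/measurable_EFinP.
have P := ge0_integral_itv_powR (measurable_funepos mG) (funepos_ge0 G) b01.
have Q := ge0_integral_itv_powR (measurable_funeneg mG) (funeneg_ge0 G) b01.
rewrite /Rintegral [in RHS]integralE -P -Q [in LHS]integralE.
have -> : \int[leb]_(t in `[0%R, b])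
    (fun t => (t `^ (a - 1) * g (t `^ a))%:E)^\+ t =
    \int[leb]_(t in `[0%R, b]) ((t `^ (a - 1))%:E * G^\+ (t `^ a)%R).
  apply: eq_integral => x _; rewrite !funeposE EFinM.
  by rewrite maxe_pMr ?lee_fin ?powR_ge0// mule0.
have -> : \int[leb]_(t in `[0%R, b])
    (fun t => (t `^ (a - 1) * g (t `^ a))%:E)^\- t =
    \int[leb]_(t in `[0%R, b]) ((t `^ (a - 1))%:E * G^\- (t `^ a)%R).
  apply: eq_integral => x _; rewrite !funenegE EFinM -muleN.
  by rewrite maxe_pMr ?lee_fin ?powR_ge0// mule0.
move: (integral _ _ _) (integral _ _ _) => x y.
(* The junk value +oo - +oo = -oo is preserved by scaling by a > 0. *)
have ay : a%:E * +oo = +oo by rewrite gt0_muley// lte_fin.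
have aNy : a%:E * -oo = -oo by rewrite gt0_muleNy// lte_fin.
by case: x => [x||]; case: y => [y||]; rewrite ?ay ?aNy /= ?mulr0// mulrBr.
Qed.

End power_substitution.

(** * The weighted composition on functions *)

Section weighted_composition.
Context (R : realType) (lambda : R).
Hypotheses (lambda_gt0 : 0 < lambda) (lambda_le1 : lambda <= 1).
Local Notation leb01 := (leb01 R).
Local Notation W := (weighted_comp_fun lambda).
Local Notation a := (1 / lambda).

Let a_ge1 : 1 <= a.
Proof. by rewrite ler_pdivlMr// mul1r. Qed.

Let aB1 : (1 - lambda) / lambda = a - 1.
Proof. by rewrite mulrBl mulfV// gt_eqF. Qed.

Lemma Re_weighted_comp_fun f x :
  complex.Re (W f x) = x `^ (a - 1) * complex.Re (f (x `^ a)).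
Proof. by rewrite /weighted_comp_fun Defs.ReM/= mul0r subr0 aB1. Qed.

Lemma Im_weighted_comp_fun f x :
  complex.Im (W f x) = x `^ (a - 1) * complex.Im (f (x `^ a)).
Proof. by rewrite /weighted_comp_fun Defs.ImM/= mul0r addr0 aB1. Qed.

Lemma normc_weighted_comp_fun f x :
  normc (W f x) = x `^ (a - 1) * normc (f (x `^ a)).
Proof.
by rewrite normcM/= expr0n/= addr0 sqrtr_sqr ger0_norm ?powR_ge0// aB1.
Qed.

Lemma complex_measurable_weighted_comp (f : measurableTypeR R -> R[i]) :
  complex_measurable f -> complex_measurable (W f : measurableTypeR R -> R[i]).
Proof.
move=> [mr mi]; split.
- under eq_fun do rewrite Re_weighted_comp_fun.
  apply: measurable_funM; first exact: measurable_powR.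
  by apply: (measurableT_comp mr); exact: measurable_powR.
- under eq_fun do rewrite Im_weighted_comp_fun.
  apply: measurable_funM; first exact: measurable_powR.
  by apply: (measurableT_comp mi); exact: measurable_powR.
Qed.

Lemma cLnorm_weighted_comp (p : R) (f : measurableTypeR R -> R[i]) :
  1 <= p -> complex_measurable f ->
  (cLnorm leb01 p (W f) <= cLnorm leb01 p f)%E.
Proof.
move=> p1 mf; have p0 : 0 < p by exact: lt_le_trans p1.
pose u (h : measurableTypeR R -> R[i]) x := ((normc (h x)) `^ p)%:E.
have normE h : (cLnorm leb01 p h = (\int[leb01]_x u h x) `^ p^-1)%E.
  rewrite /cLnorm unlock; congr (_ `^ _)%E; apply: eq_integral => x _ /=.
  by rewrite ger0_norm// -lecR; exact: (normr_ge0 (h x)).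
have mu h : complex_measurable h -> measurable_fun setT (u h).
  move=> mh; apply/measurable_EFinP.
  apply: (@measurableT_comp _ _ _ _ _ _ (fun y => y `^ p)) => //.
  exact: complex_measurable_normc.
have u0 h x : (0 <= u h x)%E by rewrite lee_fin powR_ge0.
have mWf := complex_measurable_weighted_comp mf.
rewrite !normE; apply: gt0_ler_poweR.
- by rewrite invr_ge0 ltW.
- by rewrite in_itv/= leey integral_ge0.
- by rewrite in_itv/= leey integral_ge0.
(* Substituting on the right only makes both integrands multiples of |f(x^a)|^p, so the weights
   alone are compared. *)
rewrite [leRHS](ge0_integral_leb01_powR a_ge1)//; last exact: mu.
apply: ae_ge0_le_integral => //.
- exact: mu.
- move=> x _; apply: mule_ge0 => //.
  by rewrite lee_fin mulr_ge0 ?powR_ge0// (le_trans _ a_ge1).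
- apply: emeasurable_funM.
    by apply/measurable_EFinP; exact: measurable_funM.
  by apply: (measurableT_comp (mu _ mf)); exact: measurable_powR.
have [N [mN N0 sN]] := leb01_ae_gt0_le1 R; exists N; split => //.
apply: subset_trans sN => x; apply: contra_not => /= /andP[x0 x1] _.
rewrite /u normc_weighted_comp_fun -EFinM lee_fin.
have nf0 : 0 <= normc (f (x `^ a)) by rewrite -lecR; exact: (normr_ge0 (f _)).
rewrite powRM ?powR_ge0// ler_wpM2r ?powR_ge0//.
(* The first inequality uses x <= 1 and (a-1)p >= a-1, the second a >= 1. *)
rewrite -powRrM (@le_trans _ _ (x `^ (a - 1)))//.
  by apply: ger_powR; rewrite ?x0// ler_peMr// subr_ge0.
by rewrite ler_peMl ?powR_ge0.
Qed.

(** Null sets pull back to null sets under x^a, so the formula descends to classes. *)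
Lemma weighted_comp_ae (f g : measurableTypeR R -> R[i]) :
  f = g %[ae leb01] -> W f = W g %[ae leb01].
Proof.
move=> /(leb01_ae_powR a_ge1).
apply: filterS; first exact: (ae_filter_ringOfSetsType leb01).
by move=> x fg _; rewrite /weighted_comp_fun fg.
Qed.

Lemma cesaro_weighted_comp (f : measurableTypeR R -> R[i]) (x : R) :
  complex_measurable f -> 0 < x <= 1 ->
  cesaro_fun (W f) x = lambda%:C * W (cesaro_fun f) x.
Proof.
move=> [mr mi] x01; have /andP[x0 x1] := x01.
have lambda_neq0 : lambda != 0 by rewrite gt_eqF.
(* The substitution carries a factor a = 1/lambda; solving for the left integral produces the
   eigenvalue. *)
have IE (g : measurableTypeR R -> R) : measurable_fun setT g ->
    \int[lebesgue_measure]_(t in `[0, x]) (t `^ (a - 1) * g (t `^ a)) =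
    lambda * \int[lebesgue_measure]_(t in `[0, x `^ a]) g t.
  move=> mg; rewrite -(Rintegral_itv_powR a_ge1 mg x01).
  by rewrite mulrA div1r mulfV// mul1r.
rewrite /cesaro_fun.
under eq_Rintegral do rewrite Re_weighted_comp_fun.
under [X in _ +i* X]eq_Rintegral do rewrite Im_weighted_comp_fun.
rewrite (IE _ mr) (IE _ mi) /weighted_comp_fun aB1.
set I := Rintegral _ _ _; set J := Rintegral _ _ _.
have -> : lambda * I +i* (lambda * J) = lambda%:C * (I +i* J).
  by apply/eqP; rewrite eq_complex/= !mul0r subr0 addr0 !eqxx.
(* This splits the Cesàro factor at x into the weight at x times the Cesàro factor at x^a, as they
   occur in [W (cesaro_fun f) x]. *)
have -> : x^-1 = x `^ (a - 1) * (x `^ a)^-1.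
  have x_neq0 : x != 0 by rewrite gt_eqF.
  rewrite powRD ?x_neq0 ?implybT// mulrAC mulfV ?mul1r ?powR_inv1//.
    exact: ltW.
  by rewrite gt_eqF// powR_gt0.
by rewrite rmorphM/= !mulrA [_ * lambda%:C]mulrC !mulrA.
Qed.

(** * The operator on classes, and the intertwining relation *)

Section operator.
Variables (p : R) (p1 : 1 < p).

Lemma weighted_comp_cLfunP (f : cLfunType leb01 (ltW p1)) :
  W f \in cLfun_pred leb01 p.
Proof.
have /cLfunP[mf fy] := cLfun_valP f; apply/cLfunP; split.
  exact: complex_measurable_weighted_comp.
exact: le_lt_trans (cLnorm_weighted_comp (ltW p1) mf) fy.
Qed.

Definition weighted_comp_cLfun f : cLfunType leb01 (ltW p1) :=
  CLfun (ltW p1) (weighted_comp_cLfunP f).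

Definition weighted_comp (F : Lp01 p1) : Lp01 p1 :=
  cLclass (weighted_comp_cLfun (repr F)).

(** Independence of the representative picked by [repr]. *)
Lemma weighted_comp_class f :
  weighted_comp (cLclass f) = cLclass (weighted_comp_cLfun f).
Proof.
by apply/cLclassP; apply: weighted_comp_ae; exact: cLspace_fun_ae.
Qed.

Lemma weighted_comp_linear : linear weighted_comp.
Proof.
move=> k F G; rewrite -(cLclassK F) -(cLclassK G).
have ZE (f : cLfunType leb01 (ltW p1)) : k *: cLclass f = cLclass (k *: f).
  by rewrite cLclassZ.
rewrite ZE -cLclassD !weighted_comp_class ZE -cLclassD; apply/cLclassP.
apply: (@aeW _ _ _ leb01) => x _ /=.
rewrite [LHS](_ : _ = (x `^ ((1 - lambda) / lambda))%:C *
   (k * repr F (x `^ a) + repr G (x `^ a)))//.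
by rewrite mulrDr mulrCA.
Qed.

Lemma weighted_comp_bounded :
  exists M : R, forall F, `|weighted_comp F| <= M%:C * `|F|.
Proof.
(* The bound 1 is the contraction estimate on functions. *)
exists 1 => F; rewrite mul1r.
have /cLfunP[mf fy] := cLfun_valP (repr F).
have /cLfunP[_ wfy] := cLfun_valP (weighted_comp_cLfun (repr F)).
rewrite -[in leRHS](cLclassK F).
rewrite [leLHS](cLspace_norm_class _) [leRHS](cLspace_norm_class _) lecR.
apply: fine_le; rewrite ?ge0_fin_numE ?Lnorm_ge0//.
exact: (cLnorm_weighted_comp (ltW p1) mf).
Qed.

HB.instance Definition _ := GRing.isLinear.Build R[i] (Lp01 p1) (Lp01 p1) _
  weighted_comp weighted_comp_linear.

Definition weighted_comp_operator : bounded_operator (Lp01 p1) :=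
  BoundedOperator weighted_comp_bounded.

Lemma weighted_comp_operatorE : given_by weighted_comp_operator W.
Proof.
move=> f; rewrite [X in cLspace_fun X](weighted_comp_class f).
exact: cLspace_fun_ae.
Qed.

(** The witness is the class of the constant 1, whose image is the weight itself, positive on ]0,
    1]. *)
Lemma weighted_comp_neq0 : exists F, weighted_comp_operator F != 0.
Proof.
have leb01T : leb01 setT = 1%E.
  rewrite [LHS]/(lebesgue_measure _) setTI [LHS]lebesgue_measure_itv/=.
  by rewrite lte_fin ltr01 sube0.
have c1P : (cst 1 : measurableTypeR R -> R[i]) \in cLfun_pred leb01 p.
  apply/cLfunP; split; first by split; exact: measurable_cst.
  rewrite /cLnorm (_ : _ \o _ = cst 1%E); last first.
    by apply/funext => x /=; rewrite expr1n expr0n/= addr0 sqrtr1.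
  rewrite unlock; apply: poweR_lty => /=.
  rewrite (eq_integral (cst 1%E)); last by move=> x _; rewrite /= normr1 powR1.
  by rewrite integral_cst// mul1e leb01T ltry.
pose c1 : cLfunType leb01 (ltW p1) := CLfun (ltW p1) c1P.
have class0 : cLclass (0 : cLfunType leb01 (ltW p1)) = 0.
  by apply: (addrI (cLclass 0)); rewrite -cLclassD !addr0.
exists (cLclass c1); apply/eqP.
rewrite [LHS]weighted_comp_class -class0 => /cLclassP W0.
(* If the image were zero, a false statement would hold almost everywhere, making the whole line
   null although its mass is 1. *)
have [N [mN N0 sN]] : {ae leb01, forall x : R, False}.
  have F := ae_filter_ringOfSetsType leb01.
  apply: (@filterS2 _ _ F _ _ _ _ W0 (leb01_ae_gt0_le1 R)) => x.
  move=> /(_ Logic.I) + /andP[x0 _]; rewrite /= /weighted_comp_fun mulr1.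
  move=> -[/eqP].
  by rewrite gt_eqF// powR_gt0.
have : leb01 N = 1%E by rewrite (_ : N = setT)// -subTset => x _; exact: sN.
by rewrite N0 => /eqP; rewrite eqe eq_sym oner_eq0.
Qed.

Lemma cesaro_weighted_comp_operator (C1 : bounded_operator (Lp01 p1))
    (C1E : given_by C1 (@cesaro_fun R)) (F : Lp01 p1) :
  C1 (weighted_comp_operator F) = lambda%:C *: weighted_comp_operator (C1 F).
Proof.
rewrite -(cLclassK F) [X in C1 X](weighted_comp_class _).
set f := repr F; rewrite -(cLclassK (C1 (cLclass f))) -(cLclassK (C1 _)).
rewrite [weighted_comp_operator _]weighted_comp_class.
rewrite [RHS](_ : _ = cLclass
  (lambda%:C *: weighted_comp_cLfun (repr (C1 (cLclass f))))); last first.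
  by rewrite cLclassZ.
apply/cLclassP.
have /cLfunP[mf _] := cLfun_valP f.
(* [C1E] is used twice: at the image of [f], and at [f] itself with the a.e. equality transported
   through x^a. On ]0, 1] the identity between functions then links the two. *)
have L := C1E (weighted_comp_cLfun f).
have Q := weighted_comp_ae (C1E f).
have aeF := ae_filter_ringOfSetsType leb01.
apply: (@filterS3 _ _ aeF _ _ _ _ _ L Q (leb01_ae_gt0_le1 R)).
move=> x {}L {}Q x01 _.
by rewrite [LHS]L// [LHS]cesaro_weighted_comp// -Q.
Qed.

End operator.
End weighted_composition.

Theorem theorem4p1 (R : realType) (p : R) (p1 : 1 < p)
    (C1 : bounded_operator (Lp01 p1)) (C1E : given_by C1 (@cesaro_fun R))
    (lambda : R) (lambda_gt0 : 0 < lambda) (lambda_le1 : lambda <= 1) :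
  extended_eigenvalue C1 lambda%:C /\
  exists2 X0 : bounded_operator (Lp01 p1),
    given_by X0 (weighted_comp_fun lambda) &
    extended_eigenoperator C1 lambda%:C X0.
Proof.
have X0E : extended_eigenoperator C1 lambda%:C
    (weighted_comp_operator lambda_gt0 lambda_le1 p1).
  split; first exact: weighted_comp_neq0.
  exact: cesaro_weighted_comp_operator.
split; first by eexists; exact: X0E.
exists (weighted_comp_operator lambda_gt0 lambda_le1 p1) => //.
exact: weighted_comp_operatorE.
Qed.
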